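(* Let $r\ge 1$ be an integer, let $\mathcal O\subseteq\mathbb R^{n+m}$ be open, let $f:\mathcal O\to\mathbb R^n$ be of class $C^r$, and let $N$ be a positive integer. Define $$E_\star:\mathfrak B_N^{+}\to\mathcal D_N,\qquad E_\star(\mathbf w):=\operatorname{col}(x_0,u_0,\ldots,u_{N-1})\quad\text{for }\mathbf w=\operatorname{col}(u_0,\ldots,u_{N-1},x_0,\ldots,x_N),$$ $$D_\star:\mathcal D_N\to\mathfrak B_N^{+},\qquad D_\star(q):=\Phi_N(q).$$ Then $$E_\star\circ D_\star=\operatorname{id}_{\mathcal D_N},\qquad D_\star\circ E_\star=\operatorname{id}_{\mathfrak B_N^{+}}.$$ Hence $E_\star$ and $D_\star$ form an exact $C^r$ encoder--decoder pair for $\mathfrak B_N^{+}$, that is, they are mutually inverse $C^r$ maps.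
   Context: Here $n,m,N$ are positive integers and $\operatorname{col}(\cdot)$ denotes vertical stacking of vectors. A pair $(x,u)\in\mathbb R^n\times\mathbb R^m$ is identified with a point of $\mathbb R^{n+m}$. The terminal-state-augmented $N$-step behavior of $x_{k+1}=f(x_k,u_k)$ is $$\mathfrak B_N^{+}:=\{\operatorname{col}(u_0,\ldots,u_{N-1},x_0,\ldots,x_N)\in\mathbb R^{Nm+(N+1)n} : (x_k,u_k)\in\mathcal O,\ x_{k+1}=f(x_k,u_k),\ k=0,\ldots,N-1\},$$ with $u_k\in\mathbb R^m$, $x_k\in\mathbb R^n$. It is a $C^r$ embedded submanifold of $\mathbb R^{Nm+(N+1)n}$, and $C^r$ regularity of maps into or out of it is meant with respect to this structure. Free coordinates: $q=\operatorname{col}(x_0,u_0,\ldots,u_{N-1})\in\mathbb R^{n+Nm}$. Rollout: $x_0(q)=x_0$ and, recursively, whenever the previous states are well-defined and $(x_k(q),u_k)\in\mathcal O$, $x_{k+1}(q)=f(x_k(q),u_k)$. The admissible rollout domain $\mathcal D_N\subseteq\mathbb R^{n+Nm}$ is the set of all $q$ such that $(x_k(q),u_k)\in\mathcal O$ for $k=0,\ldots,N-1$; it is an open subset of $\mathbb R^{n+Nm}$. The rollout parameterization is $\Phi_N:\mathcal D_N\to\mathbb R^{Nm+(N+1)n}$, $\Phi_N(q)=\operatorname{col}(u_0,\ldots,u_{N-1},x_0(q),x_1(q),\ldots,x_N(q))$; its image is $\mathfrak B_N^{+}$. *)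

(* Defs.v *)
From HB Require Import structures.
From mathcomp Require Import all_boot all_order all_algebra.
From mathcomp Require Import all_classical all_reals all_analysis.
Set Implicit Arguments.
Unset Strict Implicit.
Unset Printing Implicit Defensive.
Import Order.TTheory GRing.Theory Num.Theory.
Import numFieldNormedType.Exports.
Local Open Scope classical_set_scope.
Local Open Scope ring_scope.

(* Vectors of R^k are row vectors 'rV[R]_k, and col(a, b) is [row_mx a b].  A
   partially defined map is a total function together with its domain; its
   values outside the domain are never used. *)

(* [Cr_on r U f]: f is of class C^r on U, a set meant to be open.  The
   derivative at x is the Jacobian matrix, flattened into R^(a * b). *)
Fixpoint Cr_on (R : realType) (a b r : nat) (U : set 'rV[R]_a)
    (f : 'rV[R]_a -> 'rV[R]_b) {struct r} : Prop :=
  if r is s.+1 then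
    (forall x, U x -> differentiable f x) /\
    Cr_on s U (fun x => mxvec (jacobian f x))
  else forall x, U x -> {for x, continuous f}.

(* For a <= b this is the inclusion of R^a as R^a x {0} in R^b; for b <= a it
   is the projection of R^a onto the first b coordinates. *)
Definition resize (R : realType) (a b : nat) (v : 'rV[R]_a) : 'rV[R]_b :=
  \row_(j < b) oapp (fun i : 'I_a => v ord0 i) 0 (insub (val j)).

(* A C^r slice chart of M: a C^r diffeomorphism [fwd], with inverse [bwd],
   between open sets [dom] and [cod] of R^K, which carries the intersection of
   M and [dom] onto the intersection of R^d x {0} and [cod]. *)
Record slice_chart (R : realType) (r d K : nat) (M : set 'rV[R]_K) :=
  SliceChart {
    dom : set 'rV[R]_K;
    cod : set 'rV[R]_K;
    fwd : 'rV[R]_K -> 'rV[R]_K;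
    bwd : 'rV[R]_K -> 'rV[R]_K;
    chart_dim : (d <= K)%N;
    dom_open : open dom;
    cod_open : open cod;
    fwd_cod : forall x, dom x -> cod (fwd x);
    bwd_dom : forall y, cod y -> dom (bwd y);
    fwdK : forall x, dom x -> bwd (fwd x) = x;
    bwdK : forall y, cod y -> fwd (bwd y) = y;
    fwd_Cr : Cr_on r dom fwd;
    bwd_Cr : Cr_on r cod bwd;
    chart_slice : forall x, dom x ->
      (M x <-> resize K (resize d (fwd x)) = fwd x)
  }.

Definition embedded_submanifold (R : realType) (r d K : nat)
    (M : set 'rV[R]_K) : Prop :=
  forall p, M p -> exists c : slice_chart r d M, dom c p.

(* The local coordinates in R^d on M given by a slice chart: their range, the
   coordinate map and its inverse. *)
Definition coord_range (R : realType) (r d K : nat) (M : set 'rV[R]_K)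
    (c : slice_chart r d M) : set 'rV[R]_d :=
  [set y | cod c (resize K y)].

Definition coord (R : realType) (r d K : nat) (M : set 'rV[R]_K)
    (c : slice_chart r d M) (x : 'rV[R]_K) : 'rV[R]_d :=
  resize d (fwd c x).

Definition coord_inv (R : realType) (r d K : nat) (M : set 'rV[R]_K)
    (c : slice_chart r d M) (y : 'rV[R]_d) : 'rV[R]_K :=
  bwd c (resize K y).

(* F : M -> M' is of class C^r between embedded submanifolds of dimensions d
   and d': around each point it reads as a C^r map in suitable local
   coordinates.  An open subset of R^d is the case d = K. *)
Definition Cr_map (R : realType) (r d d' K K' : nat)
    (M : set 'rV[R]_K) (M' : set 'rV[R]_K') (F : 'rV[R]_K -> 'rV[R]_K') : Prop :=
  (forall p, M p -> M' (F p)) /\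
  forall p, M p ->
    exists (c : slice_chart r d M) (c' : slice_chart r d' M'),
      [/\ dom c p,
          (forall x, M x -> dom c x -> dom c' (F x)) &
          Cr_on r (coord_range c) (fun y => coord c' (F (coord_inv c y)))].

(* w = col(u_0, ..., u_(N-1), x_0, ..., x_N); [mxvec] stacks the rows of a
   matrix. *)
Definition traj_input (R : realType) (n m N : nat)
    (w : 'rV[R]_(N * m + N.+1 * n)) (k : 'I_N) : 'rV[R]_m :=
  row k (vec_mx (lsubmx w)).

Definition traj_state (R : realType) (n m N : nat)
    (w : 'rV[R]_(N * m + N.+1 * n)) (k : 'I_N.+1) : 'rV[R]_n :=
  row k (vec_mx (rsubmx w)).

Definition behavior (R : realType) (n m N : nat) (O : set 'rV[R]_(n + m))
    (f : 'rV[R]_(n + m) -> 'rV[R]_n) : set 'rV[R]_(N * m + N.+1 * n) :=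
  [set w | forall k : 'I_N,
     let xu := row_mx (traj_state w (widen_ord (leqnSn N) k))
                      (traj_input w k) in
     O xu /\ traj_state w (lift ord0 k) = f xu].

(* q = col(x_0, u_0, ..., u_(N-1)); the value for k >= N is irrelevant. *)
Definition free_input (R : realType) (n m N : nat) (q : 'rV[R]_(n + N * m))
    (k : nat) : 'rV[R]_m :=
  oapp (fun i : 'I_N => row i (vec_mx (rsubmx q))) 0 (insub k).

Fixpoint rollout (R : realType) (n m N : nat)
    (f : 'rV[R]_(n + m) -> 'rV[R]_n) (q : 'rV[R]_(n + N * m)) (k : nat) :
    'rV[R]_n :=
  if k is j.+1 then f (row_mx (rollout f q j) (free_input q j))
  else lsubmx q.

Definition rollout_domain (R : realType) (n m N : nat) (O : set 'rV[R]_(n + m))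
    (f : 'rV[R]_(n + m) -> 'rV[R]_n) : set 'rV[R]_(n + N * m) :=
  [set q | forall k, (k < N)%N -> O (row_mx (rollout f q k) (free_input q k))].

Definition Phi (R : realType) (n m N : nat) (f : 'rV[R]_(n + m) -> 'rV[R]_n)
    (q : 'rV[R]_(n + N * m)) : 'rV[R]_(N * m + N.+1 * n) :=
  row_mx (rsubmx q) (mxvec (\matrix_(k < N.+1) rollout f q k)).

Definition Estar (R : realType) (n m N : nat)
    (w : 'rV[R]_(N * m + N.+1 * n)) : 'rV[R]_(n + N * m) :=
  row_mx (traj_state w ord0) (lsubmx w).

Definition Dstar (R : realType) (n m N : nat)
    (f : 'rV[R]_(n + m) -> 'rV[R]_n) (q : 'rV[R]_(n + N * m)) :
    'rV[R]_(N * m + N.+1 * n) := Phi f q.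

(* Main.v *)
Require Import Defs.
From HB Require Import structures.
From mathcomp Require Import all_boot all_order all_algebra.
From mathcomp Require Import all_classical all_reals all_analysis.
Import Order.TTheory GRing.Theory Num.Theory.
Import numFieldNormedType.Exports.
Local Open Scope classical_set_scope.
Local Open Scope ring_scope.
Set Implicit Arguments.
Unset Strict Implicit.
Unset Printing Implicit Defensive.

(** A trajectory is determined by its initial state and its inputs, so the
    behavior is a graph: it consists of the w whose free coordinates E w lie in
    the rollout domain D and which satisfy w = Phi (E w) (lemma [behaviorE]).
    Together with E (Phi q) = q ([EstarK]) this makes E and Phi mutually
    inverse.  The states x_k(q) arise from linear coordinate maps by repeated
    composition with f; hence D is open and Phi is of class C^r on D
    ([rollout_Cr], [Phi_Cr]).

    A graph is flattened by subtracting the function it is the graph of, and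
    this gives one slice chart for the whole behavior ([graph_chart]).  The
    difference w - Phi (E w) is annihilated by E, and for the chosen ordering
    of coordinates the kernel of E is exactly the set of vectors whose first
    n + N m entries vanish ([Estar_eq0]).  So, padding vectors with zeros,
      fwd w = (E w, 0) + (w - Phi (E w))
    carries the behavior onto the slice R^(n + N m) x {0} and remembers the
    free coordinates E w in its first n + N m entries, from which w is
    recovered.  Read in this chart and in the identity chart of D, both E and
    Phi become the identity map of D, which is C^r ([graph_proj_Cr],
    [graph_param_Cr]).

    The analytic ingredient is that C^r maps are closed under sums, pairing and
    composition.  It is proved for scalar functions and their partial
    derivatives, where the induction on r only needs the Leibniz rule and the
    chain rule, and carried over to vector-valued maps by [Cr_onP]. *)

(** * Functions of class C^r through partial derivatives *)

(** Differentiability depends only on the germ of the function: a nearby equal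
    function satisfies the same first-order expansion, and differentials are
    unique. *)
Lemma near_eq_differentiable (R : numFieldType) (V W : normedModType R)
    (f g : V -> W) (x : V) :
  {near x, f =1 g} -> differentiable f x -> differentiable g x.
Proof.
move=> fg df; have [dfc dfx] := (diff_locallyP x f).1 df.
have gE : g \o shift x = cst (g x) + 'd f x +o_ 0 id.
  apply/eqaddoP => e e0; move/eqaddoP: dfx => /(_ e e0).
  have := fg; rewrite (near_shift 0 x) subr0 /= => fg0.
  rewrite -(nbhs_singleton fg).
  apply: filterS2 fg0 => y; rewrite /= => fgy.
  by rewrite -[X in X -> _]/(is_true (`|f (y + x) - (f x + 'd f x y)| <= _)) fgy.
by apply/diff_locallyP; rewrite (diff_unique dfc gE).
Qed.

(** The norm of a row vector is a maximum over finitely many entries. *)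
Lemma cvg_row (R : realType) (T : Type) (F : set_system T) b {FF : Filter F}
    (f : T -> 'rV[R]_b) (l : 'rV[R]_b) :
  (forall j, f y 0 j @[y --> F] --> l 0 j) -> f @ F --> l.
Proof.
move=> fc; apply/cvgrPdist_le => e e0; near=> y.
rewrite [leLHS]/Num.Def.normr/= mx_normrE (bigmax_le _ (ltW e0))//= => -[i j] _.
rewrite !mxE/= ord1; move: j {i}; near: y; apply: filter_forall => /= j.
exact: ((cvgrPdist_le _ _).1 (fc j)).
Unshelve. all: by end_near. Qed.

Section ComponentwiseCr.
Variables (R : realType) (a : nat).
Implicit Types (U : set 'rV[R]_a) (g h : 'rV[R]_a -> R).

(** The counterpart of [Cr_on] for scalar functions: the iterated flattened
    Jacobians are replaced by iterated partial derivatives, so that the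
    codomain stays R and sums and products of the derivatives make sense. *)
Fixpoint Cr_fun (r : nat) U g {struct r} : Prop :=
  if r is s.+1 then
    (forall x, U x -> differentiable g x) /\
    forall i, Cr_fun s U (fun x => 'D_(delta_mx 0 i) g x)
  else forall x, U x -> {for x, continuous g}.

(** Openness of U matters: a derivative at a point of U only sees values taken
    in U.  This is what lets the differentiation rules, which hold on U only,
    be used under the recursion of [Cr_fun]. *)
Lemma eq_Cr_fun r U g h : open U -> (forall x, U x -> g x = h x) ->
  Cr_fun r U g -> Cr_fun r U h.
Proof.
move=> oU; elim: r g h => [|r IH] g h gh /=.
  have near_gh x : U x -> {near x, g =1 h}.
    by move=> Ux; apply: filterS (open_nbhs_nbhs (conj oU Ux)) => y /gh.
  move=> gc x Ux; rewrite /prop_for /continuous_at -(gh _ Ux).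
  apply: cvg_trans (gc x Ux).
  exact: (@near_eq_cvg _ _ (nbhs x) _ g h (near_gh x Ux)).
have near_gh x : U x -> {near x, g =1 h}.
  by move=> Ux; apply: filterS (open_nbhs_nbhs (conj oU Ux)) => y /gh.
case=> gd gD; split=> [x Ux|i].
  exact: near_eq_differentiable (near_gh x Ux) (gd x Ux).
apply: IH (gD i) => x Ux.
exact/near_eq_derive/near_gh.
Qed.

Lemma continuous_rowP b (f : 'rV[R]_a -> 'rV[R]_b) x :
  {for x, continuous f} <-> forall j, {for x, continuous (fun y => f y 0 j)}.
Proof.
split=> [fc j|fc].
  apply: (@continuous_comp _ _ _ f (fun M : 'rV[R]_b => M 0 j)) => //.
  exact: coord_continuous.
exact: (@cvg_row _ _ _ _ (nbhs_filter x) _ (f x)).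
Qed.

Lemma differentiable_rowP b (f : 'rV[R]_a -> 'rV[R]_b) x :
  differentiable f x <-> forall j, differentiable (fun y => f y 0 j) x.
Proof.
split=> [fd j|fd].
  exact: (differentiable_comp fd (differentiable_coord _ _ _)).
have -> : f = \sum_(j < b) (fun y => f y 0 j *: (delta_mx 0 j : 'rV[R]_b)).
  apply/funext => y; rewrite [LHS]row_sum_delta fct_sumE.
  by [].
by apply: differentiable_sum => j; apply: differentiableZl.
Qed.

Lemma jacobianE b (f : 'rV[R]_a -> 'rV[R]_b) x i j : differentiable f x ->
  jacobian f x i j = 'D_(delta_mx 0 i) (fun y => f y 0 j) x.
Proof.
move=> fd; have := deriveEjacobian (delta_mx 0 i) fd.
rewrite -rowE derive_mx; last exact: diff_derivable.
by move=> /rowP/(_ j); rewrite !mxE.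
Qed.

(** The entries of the Jacobian are the partial derivatives of the components,
    and [mxvec] merely renames the entries. *)
Lemma Cr_onP b r U (f : 'rV[R]_a -> 'rV[R]_b) : open U ->
  Cr_on r U f <-> forall j, Cr_fun r U (fun x => f x 0 j).
Proof.
move=> oU; elim: r b f => [|r IH] b f /=.
  split=> [fc j x Ux|fc x Ux]; first exact: (continuous_rowP _ _).1 (fc x Ux) j.
  by apply/continuous_rowP => j; apply: fc.
split=> [[fd /IH fJ] j|fC].
  split=> [x Ux|i]; first exact: (differentiable_rowP _ _).1 (fd x Ux) j.
  apply: eq_Cr_fun oU _ (fJ (mxvec_index i j)) => x Ux.
  by rewrite mxvecE jacobianE //; apply: fd.
have fd x : U x -> differentiable f x.
  by move=> Ux; apply/differentiable_rowP => j; apply: (fC j).1.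
split=> //; apply/IH => k; case/mxvec_indexP: k => i j.
apply: eq_Cr_fun oU _ ((fC j).2 i) => x Ux.
by rewrite mxvecE jacobianE //; apply: fd.
Qed.

Lemma Cr_fun_continuous r U g : Cr_fun r U g ->
  forall x, U x -> {for x, continuous g}.
Proof.
by case: r => [//|r] /= [gd _] x Ux; apply/differentiable_continuous/gd.
Qed.

Lemma Cr_fun_pred r U g : Cr_fun r.+1 U g -> Cr_fun r U g.
Proof.
elim: r g => [|r IH] g; first by move=> gC; exact: Cr_fun_continuous gC.
by case=> gd gD; split=> // i; apply: IH.
Qed.

Lemma Cr_fun_cst r U (c : R) : open U -> Cr_fun r U (fun=> c).
Proof.
move=> oU; elim: r c => [|r IH] c /=; first by move=> x _; apply: cst_continuous.
split=> [x _|i]; first exact: differentiable_cst.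
apply: eq_Cr_fun oU _ (IH 0) => x _; rewrite derive_cst //.
Qed.

Lemma Cr_fun_coord r U j : open U -> Cr_fun r U (fun x => x 0 j).
Proof.
move=> oU; case: r => [|r] /=; first by move=> x _; apply: coord_continuous.
split=> [x _|i]; first exact: differentiable_coord.
apply: eq_Cr_fun oU _ (Cr_fun_cst r (delta_mx 0 i 0 j) oU) => x _.
have := @derive_mx _ _ _ _ id x (delta_mx 0 i) (@derivable_id _ _ x _).
by rewrite derive_id => /rowP/(_ j) eij; apply: etrans eij _; rewrite mxE.
Qed.

Lemma Cr_funD r U g h : open U -> Cr_fun r U g -> Cr_fun r U h ->
  Cr_fun r U (fun x => g x + h x).
Proof.
move=> oU; elim: r g h => [|r IH] g h /=.
  by move=> gc hc x Ux; apply: continuousD; [apply: gc|apply: hc].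
move=> [gd gD] [hd hD]; split=> [x Ux|i].
  by apply: differentiableD; [apply: gd|apply: hd].
apply: eq_Cr_fun oU _ (IH _ _ (gD i) (hD i)) => x Ux.
by rewrite deriveD //; apply: diff_derivable; [apply: gd|apply: hd].
Qed.

(** Leibniz: the partial derivatives of g h are g h' + h g', sums of products
    of functions that are one degree less regular. *)
Lemma Cr_funM r U g h : open U -> Cr_fun r U g -> Cr_fun r U h ->
  Cr_fun r U (fun x => g x * h x).
Proof.
move=> oU; elim: r g h => [|r IH] g h.
  by move=> /= gc hc x Ux; apply: continuousM; [apply: gc|apply: hc].
move=> gC hC; have [gd gD] := gC; have [hd hD] := hC; split=> [x Ux|i].
  by apply: differentiableM; [apply: gd|apply: hd].
have := Cr_funD oU (IH _ _ (Cr_fun_pred gC) (hD i))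
                   (IH _ _ (Cr_fun_pred hC) (gD i)).
apply: eq_Cr_fun => // x Ux.
by rewrite deriveM //; apply: diff_derivable; [apply: gd|apply: hd].
Qed.

Lemma Cr_fun_sum r U (I : Type) (s : seq I) (F : I -> 'rV[R]_a -> R) :
  open U -> (forall i, Cr_fun r U (F i)) ->
  Cr_fun r U (fun x => \sum_(i <- s) F i x).
Proof.
move=> oU FC; elim: s => [|i s IH].
  by apply: eq_Cr_fun oU _ (Cr_fun_cst r 0 oU) => x _; rewrite big_nil.
apply: eq_Cr_fun oU _ (Cr_funD oU (FC i) IH) => x _.
by rewrite big_cons.
Qed.

End ComponentwiseCr.

(** * Calculus of C^r maps between row vectors *)

Section CrMaps.
Variable R : realType.

(** Chain rule: the partial derivatives of g o f are sums of products of those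
    of f with compositions (dg/dx_j) o f, to which the induction applies. *)
Lemma Cr_fun_comp r a b (U : set 'rV[R]_a) (V : set 'rV[R]_b)
    (f : 'rV[R]_a -> 'rV[R]_b) (g : 'rV[R]_b -> R) : open U ->
  (forall x, U x -> V (f x)) ->
  (forall j, Cr_fun r U (fun x => f x 0 j)) -> Cr_fun r V g ->
  Cr_fun r U (fun x => g (f x)).
Proof.
move=> oU fUV; elim: r g => [|r IH] g fC gC /=.
  move=> x Ux; apply: (@continuous_comp _ _ _ f g); last exact: gC (fUV _ Ux).
  by apply/(continuous_rowP f x) => j; exact: fC j x Ux.
have [gd gD] := gC.
have fd x : U x -> differentiable f x.
  by move=> Ux; apply/differentiable_rowP => j; apply: (fC j).1.
split=> [x Ux|i].
  exact: differentiable_comp (fd x Ux) (gd _ (fUV _ Ux)).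
have fC' j := Cr_fun_pred (fC j).
have := @Cr_fun_sum R a r U _ (index_enum 'I_b) _ oU
  (fun j => Cr_funM oU ((fC j).2 i) (IH _ fC' (gD j))).
apply: eq_Cr_fun => // x Ux.
have gfd : differentiable g (f x) by apply/gd/fUV.
rewrite -[RHS]/('D__ (g \o f) x) deriveE; last first.
  exact: differentiable_comp (fd x Ux) gfd.
rewrite diff_comp //=; last exact: fd.
rewrite -(deriveE _ (fd x Ux)) derive_mx; last exact/diff_derivable/fd.
rewrite [X in 'd g _ X]row_sum_delta linear_sum /=.
by apply: eq_bigr => j _; rewrite linearZ /= -deriveE // mxE.
Qed.

Lemma Cr_on_comp r a b c (U : set 'rV[R]_a) (V : set 'rV[R]_b)
    (f : 'rV[R]_a -> 'rV[R]_b) (g : 'rV[R]_b -> 'rV[R]_c) :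
  open U -> open V -> (forall x, U x -> V (f x)) ->
  Cr_on r U f -> Cr_on r V g -> Cr_on r U (g \o f).
Proof.
move=> oU oV fUV /(Cr_onP _ _ oU) fC /(Cr_onP _ _ oV) gC.
by apply/(Cr_onP _ _ oU) => j; exact: (Cr_fun_comp oU fUV fC (gC j)).
Qed.

Lemma eq_Cr_on r a b (U : set 'rV[R]_a) (f g : 'rV[R]_a -> 'rV[R]_b) :
  open U -> (forall x, U x -> f x = g x) -> Cr_on r U f -> Cr_on r U g.
Proof.
move=> oU fg /(Cr_onP _ _ oU) fC; apply/(Cr_onP _ _ oU) => j.
by apply: eq_Cr_fun oU _ (fC j) => x /fg ->.
Qed.

Lemma Cr_on_continuous r a b (U : set 'rV[R]_a) (f : 'rV[R]_a -> 'rV[R]_b) :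
  Cr_on r U f -> forall x, U x -> {for x, continuous f}.
Proof.
by case: r => [//|r] /= [fd _] x Ux; apply/differentiable_continuous/fd.
Qed.

Lemma Cr_onD r a b (U : set 'rV[R]_a) (f g : 'rV[R]_a -> 'rV[R]_b) : open U ->
  Cr_on r U f -> Cr_on r U g -> Cr_on r U (fun x => f x + g x).
Proof.
move=> oU /(Cr_onP _ _ oU) fC /(Cr_onP _ _ oU) gC.
apply/(Cr_onP _ _ oU) => j.
by apply: eq_Cr_fun oU _ (Cr_funD oU (fC j) (gC j)) => x _; rewrite mxE.
Qed.

Lemma Cr_on_linear r a b (U : set 'rV[R]_a)
    (f : {linear 'rV[R]_a -> 'rV[R]_b}) :
  open U -> Cr_on r U f.
Proof.
move=> oU; apply/(Cr_onP _ _ oU) => j.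
have := @Cr_fun_sum R a r U _ (index_enum 'I_a) _ oU
  (fun i => Cr_funM oU (Cr_fun_coord r i oU)
                   (Cr_fun_cst r (f (delta_mx 0 i) 0 j) oU)).
apply: eq_Cr_fun => // x Ux.
rewrite {2}[x]row_sum_delta linear_sum summxE.
by apply: eq_bigr => i _; rewrite linearZ /= mxE.
Qed.

Lemma Cr_on_row_mx r a b c (U : set 'rV[R]_a) (f : 'rV[R]_a -> 'rV[R]_b)
    (g : 'rV[R]_a -> 'rV[R]_c) : open U ->
  Cr_on r U f -> Cr_on r U g -> Cr_on r U (fun x => row_mx (f x) (g x)).
Proof.
move=> oU /(Cr_onP _ _ oU) fC /(Cr_onP _ _ oU) gC.
apply/(Cr_onP _ _ oU) => j; case: (split_ordP j) => k ->.
  by apply: eq_Cr_fun oU _ (fC k) => x _; rewrite row_mxEl.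
by apply: eq_Cr_fun oU _ (gC k) => x _; rewrite row_mxEr.
Qed.

End CrMaps.

Lemma Cr_onB (R : realType) r a b (U : set 'rV[R]_a)
    (f g : 'rV[R]_a -> 'rV[R]_b) :
  open U -> Cr_on r U f -> Cr_on r U g -> Cr_on r U (fun x => f x - g x).
Proof.
move=> oU fC gC; apply: Cr_onD => //.
apply: (@Cr_on_comp R r a b b U setT g -%R) => //; first exact: openT.
exact: Cr_on_linear openT.
Qed.

Lemma Cr_on_subset (R : realType) r a b (U V : set 'rV[R]_a)
    (f : 'rV[R]_a -> 'rV[R]_b) : V `<=` U -> Cr_on r U f -> Cr_on r V f.
Proof.
move=> VU; elim: r b f => [|r IH] b f /=; first by move=> fc x /VU/fc.
by case=> fd /IH fJ; split=> // x /VU/fd.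
Qed.

Lemma open_setI_preimage (T S : topologicalType) (U : set T) (V : set S)
    (f : T -> S) :
  open U -> (forall x, U x -> {for x, continuous f}) -> open V ->
  open (U `&` f @^-1` V).
Proof.
move=> oU fc oV; rewrite openE => x [Ux Vfx].
apply: filterI; first exact: open_nbhs_nbhs.
by apply: (fc x Ux); apply: open_nbhs_nbhs.
Qed.

(** * Padding and truncation of vectors *)

Section Resize.
Variable R : realType.

Fact resize_is_linear a b : linear (@resize R a b).
Proof.
move=> c u v; apply/rowP => j; rewrite !mxE.
by case: insub => [i|] /=; rewrite ?mxE ?mulr0 ?addr0.
Qed.
HB.instance Definition _ a b :=
  GRing.isLinear.Build R 'rV[R]_a 'rV[R]_b _ (@resize R a b)
    (@resize_is_linear a b).

Lemma resizeK a b : (a <= b)%N -> cancel (@resize R a b) (@resize R b a).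
Proof.
move=> ab v; apply/rowP => j; rewrite mxE.
have jb : (j < b)%N := leq_trans (ltn_ord j) ab.
by rewrite insubT /= mxE /= valK.
Qed.

Lemma resize_id a (v : 'rV[R]_a) : resize a v = v.
Proof. by apply/rowP => j; rewrite mxE valK. Qed.

Lemma resize_eq0 a b (v : 'rV[R]_a) : (b <= a)%N ->
  resize b v = 0 <-> forall i : 'I_a, (i < b)%N -> v 0 i = 0.
Proof.
move=> ba; split=> [/rowP v0 i ib|v0].
  by have := v0 (Ordinal ib); rewrite !mxE /= valK.
apply/rowP => j; rewrite !mxE; case: insubP => //= i _ ij.
by apply: v0; rewrite ij.
Qed.
End Resize.

(** * Slice chart of a graph *)

(** [P] parameterizes M by an open set D of R^d, and the linear map [E] recovers
    the parameter.  Since E is surjective by [EP], the hypothesis [E0] says that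
    it is the projection to the first d coordinates up to an isomorphism of
    R^d; so the zero-padding of R^d is a linear complement of the kernel of
    E. *)
Section GraphChart.
Variables (R : realType) (r d K : nat) (D : set 'rV[R]_d).
Variables (E : {linear 'rV[R]_K -> 'rV[R]_d}) (P : 'rV[R]_d -> 'rV[R]_K).
Hypotheses (dK : (d <= K)%N) (oD : open D) (PC : Cr_on r D P).
Hypotheses (EP : cancel P E) (E0 : forall z, E z = 0 <-> resize d z = 0).

Let M := [set w | D (E w) /\ P (E w) = w].
Let gdom := E @^-1` D.
Let gcod := @resize R K d @^-1` D.
(* Each fibre of E is translated within R^K: [gfwd] moves its base point
   P (E w) to the zero-padded parameter, [gbwd] moves it back. *)
Let gfwd w := resize K (E w) + w - P (E w).
Let gbwd y := y - resize K (resize d y) + P (resize d y).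

Let linear_open (F : {linear 'rV[R]_K -> 'rV[R]_d}) : open (F @^-1` D).
Proof.
rewrite -[X in open X]setTI; apply: open_setI_preimage openT _ oD => x _.
exact: (Cr_on_continuous (Cr_on_linear 0 F openT)).
Qed.

Let resize_gfwd w : resize d (gfwd w) = E w.
Proof.
rewrite /gfwd -addrA linearD /= resizeK // (E0 _).1 ?addr0 //.
by rewrite linearB EP subrr.
Qed.

Let E_gbwd y : E (gbwd y) = resize d y.
Proof.
rewrite /gbwd linearD EP (E0 _).2 ?add0r //.
by rewrite linearB /= resizeK // subrr.
Qed.

Let gfwd_cod w : gdom w -> gcod (gfwd w).
Proof. by rewrite /gdom /gcod /= resize_gfwd. Qed.

Let gbwd_dom y : gcod y -> gdom (gbwd y).
Proof. by rewrite /gdom /gcod /= E_gbwd. Qed.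

Let gfwdK w : gdom w -> gbwd (gfwd w) = w.
Proof.
rewrite /gbwd resize_gfwd /gfwd => _.
by rewrite addrAC subrK [X in X - _]addrC addrK.
Qed.

Let gbwdK y : gcod y -> gfwd (gbwd y) = y.
Proof. by rewrite /gfwd E_gbwd /gbwd => _; rewrite addrA addrK addrC subrK. Qed.

Let gfwd_Cr : Cr_on r gdom gfwd.
Proof.
have od := @linear_open E; apply: Cr_onB => //; last first.
  by apply: (@Cr_on_comp R r K d K gdom D E P) => //; apply: Cr_on_linear.
apply: Cr_onD => //; last exact: (Cr_on_linear r (@idfun 'rV[R]_K) od).
exact: (Cr_on_linear r (@resize R d K \o E) od).
Qed.

Let gbwd_Cr : Cr_on r gcod gbwd.
Proof.
have od := @linear_open (@resize R K d); apply: Cr_onD => //; last first.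
  apply: (@Cr_on_comp R r K d K gcod D (@resize R K d) P) => //.
  exact: Cr_on_linear.
apply: Cr_onB => //; first exact: (Cr_on_linear r (@idfun 'rV[R]_K) od).
exact: (Cr_on_linear r (@resize R d K \o @resize R K d) od).
Qed.

Let gslice w : gdom w -> M w <-> resize K (resize d (gfwd w)) = gfwd w.
Proof.
move=> Dw; rewrite resize_gfwd /gfwd -addrA; split=> [[_ ->]|].
  by rewrite subrr addr0.
move/eqP; rewrite -subr_eq0 opprD addrA subrr add0r oppr_eq0 subr_eq0.
by move/eqP => wP; split.
Qed.

Definition graph_chart : slice_chart r d M :=
  SliceChart dK (@linear_open E) (@linear_open (@resize R K d)) gfwd_cod
    gbwd_dom gfwdK gbwdK gfwd_Cr gbwd_Cr gslice.

Lemma id_slice w : D w -> D w <-> resize d (resize d w) = id w.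
Proof. by rewrite !resize_id. Qed.

Let idC := Cr_on_linear r (@idfun 'rV[R]_d) oD.

(** The identity chart, which makes the open set D a submanifold of R^d of full
    dimension. *)
Definition open_chart : slice_chart r d D :=
  @SliceChart R r d d D D D id id (leqnn d) oD oD (fun _ => id) (fun _ => id)
   (fun _ _ => erefl) (fun _ _ => erefl) idC idC id_slice.

Lemma graph_embedded : embedded_submanifold r d M.
Proof. by move=> w [DEw _]; exists graph_chart. Qed.

Lemma coord_range_graph : coord_range graph_chart = D.
Proof. by apply/seteqP; split=> y; rewrite /coord_range/= /gcod /= resizeK. Qed.

Lemma coord_range_open : coord_range open_chart = D.
Proof. by apply/seteqP; split=> y; rewrite /coord_range/= resize_id. Qed.

(** In the charts [graph_chart] and [open_chart] the projection reads as the
    identity of D. *)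
Lemma graph_proj_Cr : Cr_map r d d M D E.
Proof.
split=> [w []//|w [DEw _]]; exists graph_chart, open_chart.
split; [exact: DEw | by move=> x [] |].
rewrite coord_range_graph; apply: eq_Cr_on oD _ idC => y _.
by rewrite /Defs.coord /coord_inv /= E_gbwd resizeK // resize_id.
Qed.

(** In the charts [open_chart] and [graph_chart] the parameterization reads as
    the identity of D. *)
Lemma graph_param_Cr : Cr_map r d d D M P.
Proof.
have PM q : D q -> M (P q) by rewrite /M /= EP.
split=> // q Dq; exists open_chart, graph_chart.
split; [exact: Dq | by move=> x Dx _; exact: (PM x Dx).1 |].
rewrite coord_range_open; apply: eq_Cr_on oD _ idC => y _.
by rewrite /Defs.coord /coord_inv /= resize_gfwd EP resize_id.
Qed.

End GraphChart.

(** * The behavior as the graph of the rollout *)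

(** Pairs of ordinals are enumerated lexicographically.  Hence [mxvec] puts row
    0 of a matrix first, that is, x_0 comes right after the inputs in a
    trajectory. *)
Lemma enum_rank_pair0 m n (j : 'I_n) :
  enum_rank ((ord0 : 'I_m.+1), j) = j :> nat.
Proof.
rewrite /enum_rank enum_rank_in.unlock insubdK; last first.
  by rewrite -topredE /= cardE index_mem mem_enum.
rewrite enumT unlock /= /prod_enum enum_ordSl /= index_cat map_f ?mem_enum //.
by rewrite index_map ?index_enum_ord // => ? ? [].
Qed.

Section Rollout.
Variables (R : realType) (n m N : nat).
Implicit Types (w z : 'rV[R]_(N * m + N.+1 * n)) (q : 'rV[R]_(n + N * m)).
Implicit Types f : 'rV[R]_(n + m) -> 'rV[R]_n.

Fact Estar_is_linear : linear (@Estar R n m N).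
Proof.
move=> c u v; rewrite /Estar /traj_state !linearP /=.
by rewrite scale_row_mx add_row_mx.
Qed.
HB.instance Definition _ :=
  GRing.isLinear.Build R _ _ _ (@Estar R n m N) Estar_is_linear.

Lemma free_dim_le : (n + N * m <= N * m + N.+1 * n)%N.
Proof. by rewrite addnC leq_add2l mulSn leq_addr. Qed.

(** The first n + N m entries of a trajectory are the inputs followed by x_0,
    which are the entries collected by E in the other order. *)
Lemma Estar_eq0 z : Estar z = 0 <-> resize (n + N * m) z = 0.
Proof.
rewrite (resize_eq0 z free_dim_le).
have <- : row_mx (0 : 'rV[R]_n) 0 = 0 :> 'rV[R]_(n + N * m) by exact: row_mx0.
split=> [/eq_row_mx [x0 u0] i|z0].
  case: (split_ordP i) => k -> /= ik.
    by move/rowP: u0 => /(_ k); rewrite !mxE.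
  have kn : (k < n)%N by rewrite -(ltn_add2l (N * m)) [X in (_ < X)%N]addnC.
  have -> : k = mxvec_index ord0 (Ordinal kn).
    by apply: val_inj; rewrite /= enum_rank_pair0.
  by move/rowP: x0 => /(_ (Ordinal kn)); rewrite !mxE.
congr row_mx; apply/rowP => j; rewrite !mxE; apply: z0 => /=.
  by rewrite enum_rank_pair0 addnC ltn_add2r.
by rewrite (leq_trans (ltn_ord j)) // leq_addl.
Qed.

Lemma EstarK f : cancel (Phi f) (@Estar R n m N).
Proof.
move=> q; rewrite /Estar /Phi /traj_state row_mxKl row_mxKr mxvecK rowK /=.
exact: hsubmxK.
Qed.

Lemma traj_input_free w (k : 'I_N) : free_input (Estar w) k = traj_input w k.
Proof. by rewrite /free_input valK /= row_mxKr. Qed.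

Lemma traj_state_Phi f q k : traj_state (Phi f q) k = rollout f q k.
Proof. by rewrite /traj_state row_mxKr mxvecK rowK. Qed.

Lemma traj_input_Phi f q (k : 'I_N) : traj_input (Phi f q) k = free_input q k.
Proof. by rewrite -traj_input_free EstarK. Qed.

(** A trajectory obeys the recursion that defines the rollout, from the same
    initial state and with the same inputs. *)
Lemma behavior_rollout O f w : behavior O f w ->
  forall k : 'I_N.+1, rollout f (Estar w) k = traj_state w k.
Proof.
move=> wB [k]; elim: k => [|k IH] kN.
  by rewrite /= row_mxKl; congr traj_state; apply: val_inj.
have kN' : (k < N)%N by [].
have /= -> := IH (ltnW kN).
have [_] := wB (Ordinal kN').
rewrite -traj_input_free.
have -> : lift ord0 (Ordinal kN') = Ordinal kN by apply: val_inj.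
have -> : widen_ord (leqnSn N) (Ordinal kN') = Ordinal (ltnW kN).
  exact: val_inj.
by move=> ->.
Qed.

Lemma behaviorE O f :
  behavior (N := N) O f =
    [set w | rollout_domain O f (Estar w) /\ Phi f (Estar w) = w].
Proof.
apply/seteqP; split=> w.
  move=> wB; have wr := behavior_rollout wB; split.
    move=> k kN; have [Ok _] := wB (Ordinal kN).
    rewrite -traj_input_free -wr in Ok.
    exact: Ok.
  rewrite /Phi /Estar row_mxKr -/(Estar w).
  rewrite -[RHS]hsubmxK; congr row_mx; rewrite -[RHS]vec_mxK; congr mxvec.
  by apply/row_matrixP => k; rewrite rowK wr.
case=> Dw <- k /=; rewrite !traj_state_Phi traj_input_Phi; split=> //.
exact: (Dw k (ltn_ord k)).
Qed.

Lemma free_input_Cr r U k : open U -> Cr_on r U (fun q => free_input q k).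
Proof.
move=> oU; rewrite /free_input; case: insub => [i|] /=.
  exact: (Cr_on_linear r (row i \o vec_mx \o rsubmx) oU).
exact: (Cr_on_linear r (@GRing.zero _ \o idfun : {linear _ -> _}) oU).
Qed.

(** Openness and regularity are proved together: the domain of the next state
    is the preimage of O under a map that is C^r, hence continuous, on the
    domain of the current one. *)
Lemma rollout_Cr r O f k : open O -> Cr_on r O f ->
  let U := [set q | forall j, (j < k)%N ->
                    O (row_mx (rollout f q j) (free_input q j))] in
  open U /\ Cr_on r U (fun q : 'rV[R]_(n + N * m) => rollout f q k).
Proof.
move=> oO fC; elim: k => [|k [oU xC]] /=.
  have -> : [set q : 'rV[R]_(n + N * m) | forall j, (j < 0)%N ->
       O (row_mx (rollout f q j) (free_input q j))] = setT by apply/seteqP; split.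
  split; first exact: openT.
  exact: (Cr_on_linear r lsubmx openT).
set U := [set q | _] in oU xC.
have xuC := Cr_on_row_mx oU xC (free_input_Cr r k oU).
set V := [set q | _].
have VE : V = U `&` (fun q => row_mx (rollout f q k) (free_input q k)) @^-1` O.
  apply/seteqP; split=> q.
    by move=> Vq; split=> [j jk|]; apply: Vq => //; apply: ltnW.
  by case=> Uq Oq j; rewrite ltnS leq_eqVlt => /predU1P[->//|]; apply: Uq.
have oV : open V.
  rewrite VE; apply: open_setI_preimage => //.
  exact: Cr_on_continuous xuC.
split=> //; apply: Cr_on_comp oV oO _ _ fC; first by rewrite VE => q [].
by apply: Cr_on_subset xuC; rewrite VE; apply: subIsetl.
Qed.

Lemma Phi_Cr r O f : open O -> Cr_on r O f ->
  open (rollout_domain (N := N) O f) /\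
  Cr_on r (rollout_domain O f) (@Phi R n m N f).
Proof.
move=> oO fC; have [oD _] := rollout_Cr N oO fC; split=> //.
apply: Cr_on_row_mx => //; first exact: (Cr_on_linear r rsubmx oD).
apply/(Cr_onP _ _ oD) => l; case/mxvec_indexP: l => k j.
have [_ /Cr_on_subset xC] := rollout_Cr k oO fC.
have DU : rollout_domain (N := N) O f `<=`
    [set q | forall i, (i < k)%N -> O (row_mx (rollout f q i) (free_input q i))].
  move=> q Dq i ik.
  apply: (Dq i); exact: leq_trans ik (ltn_ord k).
have /(Cr_onP _ _ oD) kC := xC _ DU.
by apply: eq_Cr_fun oD _ (kC j) => q _; rewrite mxvecE mxE.
Qed.

End Rollout.

(** * The encoder-decoder pair *)

Unset Implicit Arguments.

Theorem corollary4p3 (R : realType) (n m N r : nat)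
    (n_gt0 : (0 < n)%N) (m_gt0 : (0 < m)%N) (N_gt0 : (0 < N)%N)
    (r_ge1 : (1 <= r)%N)
    (O : set 'rV[R]_(n + m)) (f : 'rV[R]_(n + m) -> 'rV[R]_n)
    (O_open : open O) (f_Cr : Cr_on r O f) :
  let B : set 'rV[R]_(N * m + N.+1 * n) := behavior O f in
  let D : set 'rV[R]_(n + N * m) := rollout_domain O f in
  let E_ : 'rV[R]_(N * m + N.+1 * n) -> 'rV[R]_(n + N * m) := @Estar R n m N in
  let D_ : 'rV[R]_(n + N * m) -> 'rV[R]_(N * m + N.+1 * n) := Dstar f in
  [/\ (forall w, B w -> D (E_ w)) /\ (forall q, D q -> B (D_ q)),
      (forall q, D q -> E_ (D_ q) = q),
      (forall w, B w -> D_ (E_ w) = w),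
      open D /\ embedded_submanifold r (n + N * m) B &
      Cr_map r (n + N * m) (n + N * m) B D E_ /\
      Cr_map r (n + N * m) (n + N * m) D B D_].
Proof.
move=> B D E_ D_.
have [oD PC] := Phi_Cr N O_open f_Cr.
have dK := free_dim_le n m N.
have EP := @EstarK R n m N f; have E0 := @Estar_eq0 R n m N.
have BE : B = [set w | D (E_ w) /\ D_ (E_ w) = w] by exact: behaviorE.
rewrite BE; split.
- by split=> [w []//|q Dq] /=; rewrite /E_ /D_ EP.
- by move=> q _; apply: EP.
- by move=> w [].
- by split=> //; exact: (graph_embedded dK oD PC EP E0).
- by split; [exact: (graph_proj_Cr dK oD PC EP E0)
            |exact: (graph_param_Cr dK oD PC EP E0)].
Qed.
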